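(* The process on $\mathbb N^2$ with transition operator $$\Pi f(n_1,n_2)=\mathbb E\, f(X_{n_2}+n_1-X_{n_1},\;X_{n_1}+n_2-X_{n_2})$$ is self-dual with self-duality function $$D(k_1,k_2;n_1,n_2)=\frac{n_1!\,n_2!}{(n_1-k_1)!\,(n_2-k_2)!},$$ where $D(k_1,k_2;n_1,n_2)$ is understood to be $0$ if $k_1>n_1$ or $k_2>n_2$.
   Context: $\mathbb N=\{0,1,2,\dots\}$. For $n\in\mathbb N$, $X_n$ has the binomial distribution with $n$ trials and success probability $1/2$: $\mathbb P(X_n=k)=\binom nk 2^{-n}$. In the definition of $\Pi$, $\mathbb E$ is the expectation over two independent random variables $X_{n_1},X_{n_2}$ with these distributions (attached to agent 1 and agent 2, and independent also when $n_1=n_2$), and $f:\mathbb N^2\to\mathbb R$ is arbitrary. Self-duality with function $D$ means: for all $(k_1,k_2),(n_1,n_2)\in\mathbb N^2$, $\big(\Pi D(\cdot\,;n_1,n_2)\big)(k_1,k_2)=\big(\Pi D(k_1,k_2;\cdot)\big)(n_1,n_2)$. *)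

(* Defs.v *)
From HB Require Import structures.
From mathcomp Require Import all_boot all_order all_algebra.
From mathcomp Require Import all_classical all_reals all_analysis.

Set Implicit Arguments.
Unset Strict Implicit.
Unset Printing Implicit Defensive.
Import Order.TTheory GRing.Theory Num.Theory.
Local Open Scope ring_scope.

(* [x.1] and [x.2] are the values of X_{n_1} and X_{n_2}; the product measure
   makes them independent, also when n_1 = n_2.  The truncated subtractions are
   exact almost surely, since X_n <= n.  Every subset of nat * nat is measurable
   and the law is finitely supported, so the expectation is finite for every f
   and [fine] loses nothing. *)
Definition transition_op (R : realType) (f : nat * nat -> R) (n : nat * nat) : R :=
  fine ('E_((binomial_prob n.1 (2^-1 : R) \x binomial_prob n.2 (2^-1 : R))%E)
          [fun x : nat * nat =>
             f ((x.2 + (n.1 - x.1))%N, (x.1 + (n.2 - x.2))%N)]).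

Definition self_dual (R : realType) (T : Type)
    (Pi : (T -> R) -> T -> R) (D : T -> T -> R) : Prop :=
  forall k n : T, Pi (fun k' => D k' n) k = Pi (fun n' => D k n') n.

Definition dual_fun (R : realType) (k n : nat * nat) : R :=
  if (k.1 <= n.1)%N && (k.2 <= n.2)%N then
    ((n.1)`!%:R * (n.2)`!%:R) / ((n.1 - k.1)`!%:R * (n.2 - k.2)`!%:R)
  else 0.

(* Main.v *)
Require Import Defs.
From mathcomp Require Import all_boot all_order all_algebra.
From mathcomp Require Import all_classical all_reals all_analysis.
From mathcomp Require Import zify ring.

(** Reflecting the agent-1 binomial by [i -> n_1 - i], the first coordinate of
    the new state is binomial with [N = n_1 + n_2] trials, and the second is its
    complement to [N].  With [K = k_1 + k_2], both sides of the duality relation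
    then equal [N (N-1) ... (N-K+1) / 2^K]: acting on [k] this is Vandermonde's
    identity, acting on [n] it is the joint factorial moment of a binomial
    variable and its complement. *)

Import Order.TTheory GRing.Theory Num.Theory.
Local Open Scope ring_scope.

Section binomial_sums.
Variable V : nmodType.

Lemma sum_binS (g : nat -> V) n :
  \sum_(i < n.+2) g i *+ 'C(n.+1, i) =
  \sum_(i < n.+1) g i *+ 'C(n, i) + \sum_(i < n.+1) g i.+1 *+ 'C(n, i).
Proof.
rewrite big_ord_recl bin0 mulr1n.
under eq_bigr do rewrite binS mulrnDr.
rewrite big_split addrA; congr (_ + _).
by rewrite big_ord_recr bin_small//= mulr0n addr0 [RHS]big_ord_recl bin0 mulr1n.
Qed.

(** Unnormalised form of the fact that independent binomials with [m] and [n] fair trials add up to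
    one with [m + n]; Pascal's rule [sum_binS] moves the trials over one at a time. *)
Lemma sum_bin_convolution (g : nat -> V) m n :
  \sum_(i < m.+1) (\sum_(j < n.+1) g (i + j)%N *+ 'C(n, j)) *+ 'C(m, i) =
  \sum_(k < (m + n).+1) g k *+ 'C(m + n, k).
Proof.
elim: m g => [|m IHm] g; first by rewrite big_ord1 bin0 mulr1n.
rewrite (sum_binS (fun i => \sum_(j < n.+1) g (i + j)%N *+ 'C(n, j))).
by rewrite IHm (IHm (g \o succn)) addSn sum_binS.
Qed.

End binomial_sums.

Lemma ffact_Vandermonde m n k :
  (\sum_(i < k.+1) 'C(k, i) * (m ^_ i * n ^_ (k - i)) = (m + n) ^_ k)%N.
Proof.
rewrite -bin_ffact -binomial.Vandermonde big_distrl /=; apply: eq_bigr => i _.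
have le_ik : (i <= k)%N by rewrite -ltnS.
by rewrite -!bin_ffact -(bin_fact le_ik); ring.
Qed.

Lemma sum_bin_ffact n b :
  (2 ^ b * \sum_(i < n.+1) 'C(n, i) * (n - i) ^_ b = n ^_ b * 2 ^ n)%N.
Proof.
elim: b n => [|b IHb] n.
  rewrite mul1n mul1n -[2%N]/(1 + 1)%N expnDn.
  by apply: eq_bigr => i _; rewrite !exp1n.
case: n => [|n]; first by rewrite big_ord1 !ffact0n !muln0.
(* The top term vanishes; in the others, absorbing the factor [n.+1 - i] into the binomial
   coefficient lowers both [n] and [b]. *)
rewrite big_ord_recr /= subnn ffact0n muln0 addn0.
under eq_bigr => i _.
  rewrite (_ : 'C(n.+1, i) * (n.+1 - i) ^_ b.+1 =
               n.+1 * ('C(n, i) * (n - i) ^_ b))%N; last first.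
    have le_in : (i <= n)%N by rewrite -ltnS.
    by rewrite subSn// ffactSS mulnA (mulnC 'C(_, _)) -subSn// -mul_bin_down mulnA.
  over.
by rewrite -big_distrr /= mulnCA expnS -mulnA IHb ffactSS expnS; ring.
Qed.

(** Induction on [a]: the term [i = 0] vanishes, and absorbing one factor [i] into the binomial
    coefficient lowers [n] and [a]. *)
Lemma sum_bin_ffact2 n a b :
  (2 ^ (a + b) * \sum_(i < n.+1) 'C(n, i) * (i ^_ a * (n - i) ^_ b) =
   n ^_ (a + b) * 2 ^ n)%N.
Proof.
elim: a n => [|a IHa] n.
  by under eq_bigr do rewrite mul1n; exact: sum_bin_ffact.
case: n => [|n]; first by rewrite big_ord1 !ffact0n !muln0.
rewrite big_ord_recl ffact0n muln0 add0n.
under eq_bigr => i _.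
  rewrite lift0 ffactSS subSS mulnA mulnA (mulnC 'C(_, _)).
  rewrite -mul_bin_diag -!mulnA; over.
by rewrite -big_distrr /= addSn mulnCA expnS -mulnA IHa ffactSS expnS; ring.
Qed.

Local Open Scope ereal_scope.

Lemma measurable_nat2 (A : set (nat * nat)) : measurable A.
Proof.
apply: countable_measurable => [[i j]|]; last exact: countableP.
have -> : [set (i, j)]%classic = ([set i] `*` [set j])%classic.
  by apply/seteqP; split=> [_ ->|[x y] [/= -> ->]].
exact: measurableX.
Qed.

Lemma integral_binomial_half (R : realType) n (f : nat -> R) :
  (forall k, 0 <= f k)%R ->
  \int[binomial_prob n (2^-1 : R)]_k (f k)%:E =
  ((2^-1) ^+ n * \sum_(k < n.+1) f k *+ 'C(n, k))%:E.
Proof.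
move=> f0; have p0 : (0 <= 2^-1 :> R)%R by rewrite invr_ge0.
have p1 : (2^-1 <= 1 :> R)%R by rewrite invf_le1// ler1n.
rewrite (@integral_binomial _ n _ p0 p1 (fun k => (f k)%:E))//.
(* At parameter 1/2 all weights [p ^ k * (1 - p) ^ (n - k)] equal [2^-n]. *)
have onem_half : (1 - 2^-1 = 2^-1 :> R)%R by field.
rewrite big_distrr -sumEFin; apply: eq_bigr => k _ /=.
have le_kn : (k <= n)%N by rewrite -ltnS.
by rewrite -EFinM [unstable.onem _]onem_half -exprD subnKC// mulrnAl mulrnAr.
Qed.

Local Close Scope ereal_scope.

(** Nonnegativity of [f] allows Tonelli's theorem without an integrability proof. *)
Lemma transition_opE (R : realType) (f : nat * nat -> R) m n :
  (forall x, 0 <= f x) ->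
  transition_op f (m, n) =
  (2^-1) ^+ (m + n) *
  \sum_(k < (m + n).+1) f (val k, (m + n - k)%N) *+ 'C(m + n, k).
Proof.
move=> f0; rewrite /transition_op unlock /=.
rewrite fubini_tonelli1//=; last 2 first.
- by move=> _ Y _; exact: measurable_nat2.
- by move=> x; rewrite lee_fin.
rewrite /fubini_F /=.
under eq_integral do rewrite integral_binomial_half//.
rewrite integral_binomial_half/=; last first.
  move=> i; rewrite mulr_ge0 ?exprn_ge0 ?invr_ge0//.
  by apply: sumr_ge0 => j _; rewrite mulrn_wge0.
rewrite exprD -mulrA; congr (_ * _).
under eq_bigr do rewrite -mulrnAr.
rewrite -big_distrr; congr (_ * _) => /=.
rewrite -(sum_bin_convolution _ (fun k => f (k, (m + n - k)%N))).
(* The reflection: with [m - i] for [i], the new state is [(i + j, m + n - (i + j))]. *)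
rewrite (reindex_inj rev_ord_inj) /=; apply: eq_bigr => i _.
have le_im : (i <= m)%N by rewrite -ltnS.
rewrite subSS bin_sub//; congr (_ *+ _); apply: eq_bigr => j _.
have le_jn : (j <= n)%N by rewrite -ltnS.
by congr (f (_, _) *+ _); lia.
Qed.

(** Falling factorials vanish by themselves when [k] exceeds [n], which absorbs the case split and
    makes nonnegativity evident. *)
Lemma dual_funE (R : realType) k n :
  @dual_fun R k n = (n.1 ^_ k.1 * n.2 ^_ k.2)%:R.
Proof.
rewrite /dual_fun; case: ifPn => [/andP[le1 le2]|]; last first.
  by rewrite negb_and -!ltnNge => /orP[] /ffact_small ->; rewrite ?muln0.
rewrite -(ffact_fact le1) -(ffact_fact le2) !natrM; field.
by rewrite !pnatr_eq0 -!lt0n !fact_gt0.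
Qed.

Theorem theorem3p3 (R : realType) :
  self_dual (@transition_op R) (@dual_fun R).
Proof.
move=> [k1 k2] [n1 n2].
have dual_fun_ge0 k n : 0 <= @dual_fun R k n by rewrite dual_funE ler0n.
rewrite !transition_opE//.
under eq_bigr do rewrite dual_funE -mulrnA mulnC.
under [in RHS]eq_bigr do rewrite dual_funE -mulrnA mulnC.
rewrite -!natr_sum ffact_Vandermonde.
have two_neq0 m : (2 ^ m)%:R != 0 :> R by rewrite pnatr_eq0 expn_eq0.
(* Clearing both powers of 2 brings the right side to the form of [sum_bin_ffact2]. *)
apply: (mulfI (two_neq0 (k1 + k2)%N)); apply: (mulfI (two_neq0 (n1 + n2)%N)).
rewrite [in RHS](mulrCA (2 ^ (k1 + k2))%:R) -(natrM _ (2 ^ (k1 + k2))).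
rewrite sum_bin_ffact2 !natrX !exprVn natrM natrX.
by field; rewrite !expf_neq0.
Qed.
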